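(* Let $T>0$, $t_0\in[0,T]$, and consider the backward-in-time PDE $$-\partial_t u(t,x)=\tfrac12\mathrm{Tr}\{\sigma(t,x)\sigma^T(t,x)\nabla^2u(t,x)\}+b^T(t,x)\nabla u(t,x)+c(t,x)u(t,x)+h(t,x),\quad (t,x)\in[0,T)\times\mathbb{R}^n,$$ with terminal condition $u(T,\cdot)\in\mathcal{U}_T$, where $\mathcal{U}_T=\{u\in\tilde{\mathcal{U}}\mid u(T,x)=f(x)\}$ (that is, $u(T,\cdot)\in\mathcal{U}_T$ means $u(T,\cdot)=f$). Let $\mathcal{Y}_u\subseteq\tilde{\mathcal{U}}$ be an undesirable set with $\mathcal{U}_T\cap\mathcal{Y}_u=\emptyset$. Suppose there exists a barrier functional $B(t,u)$ such that $t\mapsto B(t,u(t,\cdot))$ is continuously differentiable on $[0,T]$ along the solutions $u$ of the PDE, and such that (i) $B(t_0,u(t_0,\cdot))-B(T,u(T,\cdot))>0$ for all $u(t_0,\cdot)\in\mathcal{Y}_u$ and all $u(T,\cdot)\in\mathcal{U}_T$; (ii) $\dfrac{\mathrm{d}B(t,u(t,\cdot))}{\mathrm{d}t}\ge0$ for all $t\in[0,T]$ and all $u\in\tilde{\mathcal{U}}$, along the solutions of the PDE. Then the solutions of the PDE avoid $\mathcal{Y}_u$ at time $t_0$: every solution $u$ of the PDE with $u(T,\cdot)\in\mathcal{U}_T$ satisfies $u(t_0,\cdot)\notin\mathcal{Y}_u$.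
   Context: $b:[0,T]\times\mathbb{R}^n\to\mathbb{R}^n$, $\sigma:[0,T]\times\mathbb{R}^n\to\mathbb{R}^{n\times m}$, $c,h:[0,T]\times\mathbb{R}^n\to\mathbb{R}$ and $f:\mathbb{R}^n\to\mathbb{R}$ are given functions. $\nabla u$ and $\nabla^2u$ are the gradient and Hessian in $x$. $\tilde{\mathcal{U}}$ denotes the state space of the PDE, i.e. a space of functions of $x$ in which $u(t,\cdot)$ takes values for every solution $u$ and every $t\in[0,T]$. A barrier functional is a family $B(t,u)=\mathscr{B}(t)u$ of (not necessarily linear) maps $\mathscr{B}(t):\mathrm{Dom}(\mathscr{B})\to\mathbb{R}$, $t\in[0,T]$, with $\mathrm{Dom}(\mathscr{B})\supseteq\tilde{\mathcal{U}}$. ''Along the solutions'' means: evaluated on any solution $t\mapsto u(t,\cdot)$ of the PDE. *)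

(* Defs.v *)
From HB Require Import structures.
From mathcomp Require Import all_boot all_order all_algebra.
From mathcomp Require Import all_classical all_reals all_analysis.

Set Implicit Arguments.
Unset Strict Implicit.
Unset Printing Implicit Defensive.

Import Order.TTheory GRing.Theory Num.Theory.
Import numFieldNormedType.Exports.

Local Open Scope classical_set_scope.
Local Open Scope ring_scope.

Section DerivativeWithin.
Variable R : realType.
Implicit Types (A : set R) (g : R -> R) (t : R).

Definition slope g t (s : R) : R := (g s - g t) / (s - t).

(* The limit of the slopes runs over the points s <> t of A only: this is the
   two-sided derivative at an interior point of an interval A, and the
   one-sided one at an end point that belongs to A. The values of g outside A
   are irrelevant (for t in A). *)
Definition derivable_within A g t : Prop :=
  cvg (slope g t @ within A (t^')).

Definition derive_within A g t : R :=
  lim (slope g t @ within A (t^')).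

Definition C1_within A g : Prop :=
  (forall t, A t -> derivable_within A g t) /\
  {within A, continuous (derive_within A g)}.

End DerivativeWithin.

Section SpaceDerivatives.
Variables (R : realType) (n : nat).
Implicit Types (v : 'cV[R]_n -> R) (x : 'cV[R]_n).

Definition basis_vec (i : 'I_n) : 'cV[R]_n := delta_mx i ord0.

Definition grad v x : 'cV[R]_n := \col_i 'D_(basis_vec i) v x.

Definition hess v x : 'M[R]_n :=
  \matrix_(i, j) 'D_(basis_vec i) (fun y => grad v y j ord0) x.

(* 'D_ is total: existence of the partial derivatives of order one and two has
   to be required separately. *)
Definition has_partials2 v : Prop :=
  forall x (i j : 'I_n),
    derivable v x (basis_vec i) /\
    derivable (fun y => grad v y j ord0) x (basis_vec i).

End SpaceDerivatives.

Section BackwardPDE.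
Variables (R : realType) (n m : nat).

(* u is given on R * R^n, but only its restriction to [0, T] * R^n matters. *)
Implicit Type u : R -> 'cV[R]_n -> R.

Definition time_space (I : set R) : set (R * 'cV[R]_n) := I `*` setT.

Definition dt (T : R) u (t : R) (x : 'cV[R]_n) : R :=
  derive_within `[0, T[ (fun s => u s x) t.

(* u is in C([0,T] * R^n) and in C^{1,2}([0,T) * R^n); continuity up to t = T
   is what ties u(T,.) to the values of u on [0,T). *)
Definition C12 (T : R) u : Prop :=
  [/\ {within time_space `[0, T], continuous (fun p => u p.1 p.2)},
      forall t x, t \in `[0, T[ ->
        derivable_within `[0, T[ (fun s => u s x) t,
      forall t, t \in `[0, T[ -> has_partials2 (u t)
    & [/\ {within time_space `[0, T[, continuous (fun p => dt T u p.1 p.2)},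
          {within time_space `[0, T[, continuous (fun p => grad (u p.1) p.2)}
        & {within time_space `[0, T[, continuous (fun p => hess (u p.1) p.2)}]].

(* Classical solutions with values in the state space U; no terminal
   condition is imposed here. *)
Definition pde_solution (T : R)
    (b : R -> 'cV[R]_n -> 'cV[R]_n) (sigma : R -> 'cV[R]_n -> 'M[R]_(n, m))
    (c h : R -> 'cV[R]_n -> R) (U : set ('cV[R]_n -> R)) u : Prop :=
  [/\ forall t, t \in `[0, T] -> U (u t),
      C12 T u
    & forall t x, t \in `[0, T[ ->
        - dt T u t x =
          2^-1 * \tr (sigma t x *m (sigma t x)^T *m hess (u t) x)
          + ((b t x)^T *m grad (u t) x) ord0 ord0
          + c t x * u t x + h t x].

Definition terminal_set (U : set ('cV[R]_n -> R)) (f : 'cV[R]_n -> R) :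
    set ('cV[R]_n -> R) :=
  [set v | U v /\ forall x, v x = f x].

End BackwardPDE.

(* Main.v *)
Require Import Defs.
From HB Require Import structures.
From mathcomp Require Import all_boot all_order all_algebra.
From mathcomp Require Import all_classical all_reals all_analysis.

Import Order.TTheory GRing.Theory Num.Theory.
Import numFieldNormedType.Exports.

Local Open Scope classical_set_scope.
Local Open Scope ring_scope.

(** Along a solution [u] ending in the terminal set, condition (ii) makes [B t (u t)] nondecreasing
    on [[0, T]], so [B t0 (u t0) <= B T (u T)]. If [u t0] were in [Yu], condition (i) would give the
    strict opposite inequality. The analytic content is monotonicity from a nonnegative derivative
    taken within a closed interval, [derive_within_ge0_homo]. It reduces to the classical mean value
    argument, which wants continuity up to the end points ([derivable_within_continuous]) and a
    two-sided derivative inside ([is_derive_within]). *)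

Section DerivativeWithin.
Context {R : realType}.
Implicit Types (A : set R) (g : R -> R) (t : R).

(** Write [g s = g t + slope g t s * (s - t)]: the slope has a finite limit and [s - t] tends to
    0. *)
Lemma derivable_within_cvg {A g t} :
  derivable_within A g t -> g s @[s --> within A t^'] --> g t.
Proof.
move=> /cvg_ex[l gl].
have idt : s @[s --> within A t^'] --> t.
  by apply: cvg_within_filter; exact: cvg_within.
have : g t + slope g t s * (s - t) @[s --> within A t^'] --> g t + l * (t - t).
  apply: cvgD; first exact: cvg_cst.
  by apply: cvgM => //; apply: cvgB => //; exact: cvg_cst.
rewrite subrr mulr0 addr0; apply: cvg_trans; apply: near_eq_cvg.
have : \forall s \near within A t^', s != t.
  by apply: cvg_within; exact: withinT.
apply: filterS => s st.
by rewrite /slope divfK ?subr_eq0// addrC subrK.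
Qed.

Lemma derivable_within_continuous {A g} :
  (forall t, A t -> derivable_within A g t) -> {within A, continuous g}.
Proof.
move=> dg; apply/subspace_continuousP => t At V gtV.
have /= := derivable_within_cvg (dg _ At) _ gtV.
rewrite !near_simpl !near_withinE; apply: filterS => s sV As.
(* The punctured limit says nothing at [s = t]; there [g t] lies in [V] because [V] is a
   neighbourhood of it. *)
have [->|st] := eqVneq s t; first exact: nbhs_singleton.
exact: sV.
Qed.

(** Near an interior point the restriction to [A] is vacuous, and the substitution [s = t + h] turns
    slopes into the usual difference quotients. *)
Lemma is_derive_within {A g t} : nbhs t A -> derivable_within A g t ->
  is_derive t 1 g (derive_within A g t).
Proof.
move=> tA gl.
suff cl : h^-1 *: ((g \o shift t) (h *: 1) - g t) @[h --> 0^'] -->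
    derive_within A g t.
  by apply: DeriveDef; [apply/cvg_ex; exists (derive_within A g t)|exact: cvg_lim].
move=> V /gl /=; rewrite !near_simpl !near_withinE => sV.
have /nbhs0P : \forall s \near t, (s != t -> A s -> V (slope g t s)) /\ A s.
  exact: filterI.
apply: filterS => h [Vh Ath] h0.
move: Vh Ath; rewrite addrC /slope addrK mulrC => Vh Ath.
rewrite /= [h *: 1]mulr1; apply: Vh => //.
by rewrite -subr_eq0 addrK.
Qed.

Lemma derive_within_ge0_homo {a b : R} {g} :
    (forall t, t \in `[a, b] -> derivable_within `[a, b] g t) ->
    (forall t, t \in `[a, b] -> 0 <= derive_within `[a, b] g t) ->
  {in `[a, b] &, {homo g : x y / x <= y}}.
Proof.
move=> dg dg_ge0.
(* The closed interval is a neighbourhood of each point of the open one, so both notions of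
   derivative agree there. *)
have dgE t : t \in `]a, b[ -> is_derive t 1 g (derive_within `[a, b] g t).
  move=> tab; apply: is_derive_within; last exact/dg/subset_itv_oo_cc.
  by apply: filterS (near_in_itvoo tab) => s; exact: subset_itv_oo_cc.
apply: ger0_derive1_le_cc => [t /dgE[]//|t tab|].
  have [_] := dgE _ tab; rewrite derive1E => ->.
  exact/dg_ge0/subset_itv_oo_cc.
exact: derivable_within_continuous.
Qed.

End DerivativeWithin.

Theorem theorem3 (R : realType) (n m : nat) (T t0 : R)
  (b : R -> 'cV[R]_n -> 'cV[R]_n) (sigma : R -> 'cV[R]_n -> 'M[R]_(n, m))
  (c h : R -> 'cV[R]_n -> R) (f : 'cV[R]_n -> R)
  (U Yu : set ('cV[R]_n -> R)) (B : R -> ('cV[R]_n -> R) -> R)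
  (T_gt0 : 0 < T) (t0_in : t0 \in `[0, T])
  (YuU : Yu `<=` U) (UT_Yu : terminal_set U f `&` Yu = set0)
  (B_C1 : forall u, pde_solution T b sigma c h U u ->
    C1_within `[0, T] (fun t => B t (u t)))
  (B_sep : forall v w, Yu v -> terminal_set U f w -> B t0 v - B T w > 0)
  (B_incr : forall u, pde_solution T b sigma c h U u ->
    forall t, t \in `[0, T] -> 0 <= derive_within `[0, T] (fun s => B s (u s)) t) :
  forall u, pde_solution T b sigma c h U u -> terminal_set U f (u T) ->
    ~ Yu (u t0).
Proof.
move=> u u_sol uT Yu_t0.
have : B t0 (u t0) <= B T (u T).
  have [dB _] := B_C1 u u_sol.
  have [t0_ge0 t0_leT] : 0 <= t0 /\ t0 <= T.
    by apply/andP; move: t0_in; rewrite in_itv.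
  have /= Bu_homo := derive_within_ge0_homo dB (B_incr u u_sol).
  apply: Bu_homo => //.
  by rewrite in_itv/= lexx ltW.
(* Separation at [v = u t0], [w = u T] contradicts the monotonicity inequality. *)
by rewrite leNgt -subr_gt0 B_sep.
Qed.
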